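(* For $d,n\in\mathbb{Z}^+$ let $\lambda_d(n)$ be the smallest integer $m>1$ such that the numbers $(2k-1)^d$ $(k=1,\ldots,n)$ are pairwise distinct modulo $m$. Then for $d\in\{4,6,12\}$ and every integer $n>2$, $\lambda_d(n)$ is the least prime $p\geqslant 2n-1$ with $p\equiv -1\pmod d$.
   Context: $\mathbb{Z}^+=\{1,2,3,\ldots\}$. *)

(* Defs.v *)
From mathcomp Require Import all_boot all_order all_algebra.

Set Implicit Arguments.
Unset Strict Implicit.
Unset Printing Implicit Defensive.

Definition odd_powers_distinct (d n m : nat) : bool :=
  uniq [seq (2 * k - 1) ^ d %% m | k <- iota 1 n].

Definition lambda_pred (d n : nat) : pred nat :=
  [pred m | (1 < m) && odd_powers_distinct d n m].

Lemma lambda_ex (d n : nat) : 0 < d -> exists m, lambda_pred d n m.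
Proof.
move=> d_gt0; exists ((2 * n) ^ d).+2; apply/andP; split=> //.
rewrite /odd_powers_distinct map_inj_in_uniq ?iota_uniq // => i j.
have small k : k \in iota 1 n -> (2 * k - 1) ^ d < ((2 * n) ^ d).+2.
  rewrite mem_iota add1n ltnS => /andP[_ le_kn].
  rewrite ltnS leqW // leq_exp2r // (leq_trans (leq_subr _ _)) //.
  by rewrite leq_mul2l le_kn.
move=> si sj; rewrite !modn_small ?small // => /eqP; rewrite eqn_exp2r //.
move: si sj; rewrite !mem_iota => /andP[i_gt0 _] /andP[j_gt0 _] /eqP eq_ij.
have pos k : 0 < k -> 0 < 2 * k by rewrite muln_gt0.
have: 2 * i = 2 * j by rewrite -(subnK (pos i i_gt0)) eq_ij subnK ?pos.
by move/eqP; rewrite eqn_mul2l => /eqP.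
Qed.

(* No modulus exists for d = 0 and n > 1; the value 0 at d = 0 is a default
   outside the domain d > 0. *)
Definition lambda (d n : nat) : nat :=
  if d is d'.+1 then ex_minn (@lambda_ex d'.+1 n isT) else 0.

Definition is_least (P : pred nat) (p : nat) : Prop :=
  P p /\ forall q, P q -> p <= q.

Lemma lambdaP (d n : nat) : 0 < d -> is_least (lambda_pred d n) (lambda d n).
Proof. by case: d => // d _; rewrite /lambda; case: ex_minnP. Qed.

(* Main.v *)
Require Import Defs.
From mathcomp Require Import all_boot all_order all_algebra.
From mathcomp Require Import reals Rstruct exp.
From mathcomp Require Import zify ring lra.

Set Implicit Arguments.
Unset Strict Implicit.
Unset Printing Implicit Defensive.

Import Order.TTheory GRing.Theory Num.Theory.

(** A prime q = -1 modulo d with q >= 2n - 1 separates the d-th powers of the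
    odd numbers below 2n, because x^d determines x^(q+1) = x^2 modulo q.
    Conversely let m separate them and let m <= 4n - 4.  Identities such as
    (2r + s)^2 - (2r - s)^2 = 8rs exclude even m, odd m < 2n - 1 and odd
    composite m = rs; a prime m with e | gcd(d, m - 1) and e >= 4 is excluded
    since it has only (m - 1)/e nonzero e-th powers, fewer than n - 1.

    For n > 14 the bound lambda_d(n) <= 4n - 4 is Bertrand's postulate for the
    primes p = 11 modulo 12, which follows by Chebyshev's method.  With A_a(y)
    the sum of ln n over n <= y, n = a modulo 12, the combination
      A_11(x) - A_11(x/2) - A_7(x/5) - A_5(x/7) - A_1(x/10) + A_7(x/10)
        - A_11(x/10) - A_7(x/14) + A_1(x/35) - A_1(x/70)
    equals the sum of Lambda(d) W(d) over d <= x, where W is at most the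
    indicator of (x/2 < d <= x, d = 11 modulo 12) plus the indicators of
    d <= x/29 and d <= x/72.  It is at least 0.1565 x ln 2 - O(ln x), while
    psi(x/29) + psi(x/72) is at most 0.0968 x ln 2, so for large x there is a
    prime p = 11 modulo 12 in (x/2, x]. *)

(** * Moduli separating the powers of odd numbers *)

Lemma odd_powers_distinctE (d n m : nat) :
  odd_powers_distinct d n m = uniq (mkseq (fun i => (2 * i + 1) ^ d %% m) n).
Proof.
rewrite /odd_powers_distinct /mkseq (iotaDl 1 0) -map_comp; congr uniq.
by apply: eq_map => i /=; congr (_ ^ _ %% _); lia.
Qed.

Lemma odd_powers_distinctP (d n m : nat) :
  reflect (forall x y, odd x -> odd y -> x < 2 * n -> y < 2 * n ->
             x ^ d = y ^ d %[mod m] -> x = y)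
          (odd_powers_distinct d n m).
Proof.
rewrite odd_powers_distinctE.
apply: (iffP (mkseq_uniqP _ _)) => dist => [x y ox oy xn yn exy|i j].
- have half z : odd z -> z = 2 * z./2 + 1 by lia.
  rewrite (half x) // (half y) //; congr (2 * _ + 1).
  by apply: dist; rewrite ?inE; [lia | lia | rewrite -!half].
by rewrite !inE => ltin ltjn /dist; lia.
Qed.

Lemma odd_powers_distinct_dvd (e d n m : nat) :
  e %| d -> odd_powers_distinct d n m -> odd_powers_distinct e n m.
Proof.
case/dvdnP=> k ->; rewrite mulnC => /odd_powers_distinctP dist.
apply/odd_powers_distinctP => x y ox oy xn yn exy; apply: dist => //.
by rewrite !expnM -modnXm exy modnXm.
Qed.

Lemma odd_squares_collision (n m c x y : nat) : odd_powers_distinct 2 n m ->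
  odd x -> odd y -> x < 2 * n -> x * x = y * y + c * m -> x = y.
Proof.
move=> /odd_powers_distinctP dist ox oy xn exy; have yx : y <= x by nia.
apply: dist => //; first by lia.
by rewrite -!mulnn exy addnC modnMDl.
Qed.

Lemma odd_squares_distinct_even (n m : nat) :
  odd_powers_distinct 2 n m -> 2 < n -> 0 < m -> ~~ odd m -> 4 * n - 4 <= m.
Proof.
move=> dist n2 m0 em; rewrite leqNgt; apply/negP => mn.
pose q := m./2; have mq : m = 2 * q by lia.
(* The colliding pair must be odd: the squares of [q + 2] and [q - 2] differ by 8q = 4m, those of
   [q + 1] and [q - 1] by 4q = 2m. *)
have [oq|eq] := boolP (odd q).
  have [q1|q3] : q = 1 \/ 3 <= q by lia.
    by have := @odd_squares_collision n m 4 3 1 dist; lia.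
  have := @odd_squares_collision n m 4 (q + 2) (q - 2) dist.
  have : (q + 2) * (q + 2) = (q - 2) * (q - 2) + 4 * m by nia.
  by lia.
have := @odd_squares_collision n m 2 (q + 1) (q - 1) dist.
have : (q + 1) * (q + 1) = (q - 1) * (q - 1) + 2 * m by nia.
by lia.
Qed.

Lemma odd_squares_distinct_ge (n m : nat) :
  odd_powers_distinct 2 n m -> 2 < n -> 1 < m -> odd m -> 2 * n - 1 <= m.
Proof.
move=> dist n2 m1 om; rewrite leqNgt; apply/negP => mn.
have := @odd_squares_collision n m 8 (m + 2) (m - 2) dist.
have : (m + 2) * (m + 2) = (m - 2) * (m - 2) + 8 * m by nia.
by lia.
Qed.

Lemma odd_squares_distinct_mul (n r s : nat) :
  odd_powers_distinct 2 n (r * s) -> odd r -> odd s -> 0 < r ->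
  2 * n <= 2 * r + s.
Proof.
move=> dist or os r0; rewrite leqNgt; apply/negP => rsn.
have [rs|sr] := leqP (2 * r) s.
  have := @odd_squares_collision n (r * s) 8 (2 * r + s) (s - 2 * r) dist.
  have : (2 * r + s) * (2 * r + s) = (s - 2 * r) * (s - 2 * r) + 8 * (r * s).
    by nia.
  by lia.
have := @odd_squares_collision n (r * s) 8 (2 * r + s) (2 * r - s) dist.
have : (2 * r + s) * (2 * r + s) = (2 * r - s) * (2 * r - s) + 8 * (r * s).
  by nia.
by lia.
Qed.

Lemma odd_squares_distinct_prime (n m : nat) :
  odd_powers_distinct 2 n m -> 14 < n -> 1 < m -> odd m -> m <= 4 * n - 4 ->
  prime m.
Proof.
move=> dist n14 m1 om mn.
have mge : 2 * n - 1 <= m by apply: odd_squares_distinct_ge => //; lia.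
apply/negPn/negP => npm.
pose r := pdiv m; pose s := m %/ r.
have mrs : m = r * s by rewrite /r /s mulnC divnK // pdiv_dvd.
have prr : prime r by rewrite pdiv_prime.
have [or os] : odd r /\ odd s by move: om; rewrite mrs oddM => /andP[].
have r1 := prime_gt1 prr.
have s1 : s != 1 by apply: contra npm => /eqP s1; rewrite mrs s1 muln1.
have rs : r <= s.
  rewrite leqNgt; apply/negP => sr.
  suff : r <= s by lia.
  have := @pdiv_min_dvd m s; rewrite -/r; apply; first by lia.
  by rewrite mrs dvdn_mull.
(* Now rs <= 4n - 4 <= 4r + 2s - 4, so (r - 2)(s - 4) <= 4. For odd 3 <= r <= s this leaves m <= 25,
   whereas m >= 29 because n > 14. *)
have := @odd_squares_distinct_mul n r s; rewrite -mrs => /(_ dist or os).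
by nia.
Qed.

(* The e-th powers in F_q are all roots of X^((q-1)/e + 1) - X. *)
Lemma odd_powers_distinct_prime_le (e n q : nat) :
  prime q -> 0 < e -> e %| q.-1 -> odd_powers_distinct e n q ->
  n <= (q.-1 %/ e).+1.
Proof.
move=> prq e0 /dvdnP[t tE] dist; rewrite tE mulnK //.
have t0 : 0 < t by have := prime_gt1 prq; case: t tE => //; lia.
pose u := [seq ((i ^ e)%:R : 'F_q)%R | i <- [seq 2 * k - 1 | k <- iota 1 n]].
have uu : uniq u.
  apply: (@map_uniq _ _ val); rewrite -!map_comp.
  move: dist; rewrite /odd_powers_distinct; congr (is_true (uniq _)).
  by apply: eq_map => k /=; rewrite val_Fp_nat.
pose P : {poly 'F_q} := ('X^(t.+1) - 'X)%R.
have szP : size P = t.+2.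
  by rewrite /P size_polyDl ?size_polyN ?size_polyXn ?size_polyX //; lia.
have P0 : P != 0%R by rewrite -size_poly_eq0 szP.
have rP : all (root P) u.
  apply/allP => _ /mapP[i _ ->]; rewrite /root /P !hornerE subr_eq0.
  have fr : ((i ^ q)%:R = i%:R :> 'F_q)%R.
    by apply/val_inj; rewrite /= !val_Fp_nat // fermat_little.
  rewrite -natrX -expnM.
  have -> : e * t.+1 = q + e.-1 by have := prime_gt1 prq; lia.
  by rewrite expnD natrM fr -natrM -expnS prednK.
by have := max_poly_roots P0 rP uu; rewrite szP /u !size_map size_iota; lia.
Qed.

(* If q + 1 = d t then z^(d t) = z^2 modulo q, so x^d determines x^2. *)
Lemma odd_powers_distinct_prime (d n q : nat) :
  prime q -> odd q -> 2 * n - 1 <= q -> d %| q.+1 -> odd_powers_distinct d n q.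
Proof.
move=> prq oq nq /dvdnP[t tE].
apply/odd_powers_distinctP.
have sq z : z ^ (d * t) = z ^ 2 %[mod q].
  by rewrite mulnC -tE expnS -modnMmr fermat_little // modnMmr.
have not_gt x y : odd x -> odd y -> x < 2 * n -> x ^ d = y ^ d %[mod q] ->
    ~ y < x.
  move=> ox oy xn exy yx.
  have : x ^ 2 == y ^ 2 %[mod q].
    by rewrite -(sq x) -(sq y) !expnM -(modnXm _ _ (x ^ d)) exy modnXm.
  rewrite eqn_mod_dvd ?leq_exp2r ?(ltnW yx) // subn_sqr Euclid_dvdM //.
  case/orP => [/dvdn_leq|/dvdnP[k kE]]; first by lia.
  (* Here x + y = kq: k = 1 fails by parity, and k >= 2 because x + y <= 4n - 4 < 2q. *)
  have [k0|[k1|k2]] : k = 0 \/ k = 1 \/ 2 <= k by lia.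
  - by move: kE; rewrite k0; lia.
  - by move: kE; rewrite k1; lia.
  by nia.
move=> x y ox oy xn yn exy.
case: (ltngtP x y) => // ltxy; exfalso.
  exact: (not_gt y x).
exact: (not_gt x y).
Qed.

Lemma eq_opp1_modz (d q : nat) : (q == -1 %[mod d])%Z = (d %| q.+1).
Proof. by rewrite eqz_mod_dvd opprK dvdzE /= addn1. Qed.

Lemma odd_powers_distinct_minimal (d n m p : nat) : d \in [:: 4; 6; 12] ->
  14 < n -> 1 < m -> m <= p -> p <= 4 * n - 4 -> prime p ->
  odd_powers_distinct d n m -> [&& prime m, 2 * n - 1 <= m & d %| m.+1].
Proof.
move=> hd n14 m1 mp pn prp dist.
have d2 : 2 %| d by move: hd; rewrite !inE => /or3P[] /eqP ->.
have dist2 := odd_powers_distinct_dvd d2 dist.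
have om : odd m.
  (* An even m would have to be p = 4n - 4, which is not prime. *)
  apply/negPn/negP => em.
  have := odd_squares_distinct_even dist2.
  by case: (even_prime prp); lia.
have prm : prime m by apply: odd_squares_distinct_prime dist2 _ _ _ _; lia.
have mge : 2 * n - 1 <= m by apply: odd_squares_distinct_ge dist2 _ _ _; lia.
rewrite prm mge /=; apply/negPn/negP => ndm.
have nogo e : e %| d -> 3 < e -> e %| m.-1 -> False.
  move=> ed e3 em; have dist_e := odd_powers_distinct_dvd ed dist.
  have := odd_powers_distinct_prime_le prm _ em dist_e.
  have -> : 0 < e by lia.
  move=> /(_ isT); case/dvdnP: em => t tE; rewrite tE mulnK; last by lia.
  by nia.
have m3 : ~~ (3 %| m) by rewrite dvdn_prime2 //; lia.
move: hd nogo ndm; rewrite !inE => /or3P[] /eqP -> nogo ndm.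
- by apply: (nogo 4); lia.
- by apply: (nogo 6); lia.
(* The residues 1, 5, 7 modulo 12 remain: 4 divides m - 1 for 1 and 5, and 6 does for 1 and 7. *)
have [] : (4 %| m.-1) \/ (6 %| m.-1) by lia.
  exact: nogo.
exact: nogo.
Qed.

(** * Finite verification for n at most 14 *)

Fixpoint powmod (x d m : nat) : nat :=
  if d is e.+1 then (x * powmod x e m) %% m else 1 %% m.

Lemma powmodE x d m : powmod x d m = x ^ d %% m.
Proof. by elim: d => //= d ->; rewrite modnMmr expnS. Qed.

(** Reducing after each multiplication keeps the unary numerals small for [vm_compute]. *)
Lemma odd_powers_distinct_powmod d n m :
  odd_powers_distinct d n m =
  uniq [seq powmod (2 * k - 1) d m | k <- iota 1 n].
Proof.
by rewrite /odd_powers_distinct; congr uniq; apply: eq_map => k; rewrite powmodE.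
Qed.

Definition expected_value (d n : nat) : pred nat :=
  [pred q | [&& prime q, 2 * n - 1 <= q & d %| q.+1]].

Lemma small_cases d n : d \in [:: 4; 6; 12] -> n \in iota 3 12 ->
  exists2 p, expected_value d n p & forall m, 1 < m -> m <= p ->
    odd_powers_distinct d n m -> expected_value d n m.
Proof.
(* For n <= 14 the candidate is at most 47, the least prime from 27 on that is 11 modulo 12. The
   list starts at 0, so the index found is the value itself. *)
move=> hd hn; pose p d n := find (expected_value d n) (iota 0 48).
pose small d n m := uniq [seq powmod (2 * k - 1) d m | k <- iota 1 n] ==>
  expected_value d n m.
have : all (fun d => all (fun n => expected_value d n (p d n) &&
    all (small d n) (iota 2 (p d n).-1)) (iota 3 12)) [:: 4; 6; 12].
  by vm_compute.
move=> /allP/(_ _ hd)/allP/(_ _ hn)/andP[evp /allP smallP]; exists (p d n) => //.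
move=> m m1 mp; rewrite odd_powers_distinct_powmod.
by apply/implyP; apply: smallP; rewrite mem_iota; lia.
Qed.

(** * Von Mangoldt sums *)

Local Open Scope ring_scope.

Lemma sum_nat_leq (X k : nat) : (k <= X)%N ->
  (\sum_(1 <= i < X.+1) (i <= k) = k)%N.
Proof.
elim: X k => [|X IHX] k kX; first by rewrite big_geq //; lia.
rewrite big_nat_recr //=; case: (ltngtP k X.+1) kX => // [kX|->] _.
  by rewrite IHX //; lia.
rewrite -{3}(IHX X) // addn1; congr _.+1.
by rewrite [LHS]big_nat [RHS]big_nat; apply: eq_bigr => i; lia.
Qed.

(* The sum of Lambda(d) f(d) over the prime powers d = p^i with p, i <= X,
   where Lambda is the von Mangoldt function. *)
Definition mangoldt_sum (R : realType) (X : nat) (f : nat -> R) : R :=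
  \sum_(1 <= p < X.+1 | prime p) \sum_(1 <= i < X.+1) ln p%:R * f (p ^ i)%N.

Lemma ln_nat_ge0 (R : realType) (n : nat) : 0 <= ln (n%:R : R).
Proof.
case: n => [|n]; first by rewrite ln0.
by rewrite ln_ge0 // ler1n.
Qed.

Lemma mangoldt_sum_le (R : realType) (X : nat) (f g : nat -> R) :
  (forall d, (1 < d)%N -> f d <= g d) -> mangoldt_sum X f <= mangoldt_sum X g.
Proof.
move=> fg; apply: ler_sum => p prp; rewrite big_nat [leRHS]big_nat.
apply: ler_sum => i /andP[i0 _]; apply: ler_wpM2l; first exact: ln_nat_ge0.
by apply: fg; rewrite -(exp1n i) ltn_exp2r ?prime_gt1.
Qed.

Lemma mangoldt_sumD (R : realType) (X : nat) (f g : nat -> R) :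
  mangoldt_sum X (fun d => f d + g d) = mangoldt_sum X f + mangoldt_sum X g.
Proof.
rewrite -big_split; apply: eq_bigr => p _; rewrite -big_split.
by apply: eq_bigr => i _; rewrite mulrDr.
Qed.

Lemma mangoldt_sum0 (R : realType) (X : nat) :
  mangoldt_sum X (fun=> 0) = 0 :> R.
Proof.
by rewrite /mangoldt_sum big1 // => p _; rewrite big1 // => i _; rewrite mulr0.
Qed.

Lemma ln_prod_nat (R : realType) (I : Type) (r : seq I) (P : pred I)
    (F : I -> nat) : (forall i, P i -> (0 < F i)%N) ->
  ln ((\prod_(i <- r | P i) F i)%:R : R) = \sum_(i <- r | P i) ln (F i)%:R.
Proof.
move=> F0.
suff [] : (0 < \prod_(i <- r | P i) F i)%N /\
  ln ((\prod_(i <- r | P i) F i)%:R : R) = \sum_(i <- r | P i) ln (F i)%:R by [].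
elim/big_rec2: _ => [|i y z Pi [z0 <-]]; first by rewrite ln1.
rewrite muln_gt0 F0 // z0; split=> //.
by rewrite natrM lnM ?posrE ?ltr0n ?F0.
Qed.

Lemma ln_sum_logn (R : realType) (X n : nat) : (0 < n <= X)%N ->
  ln (n%:R : R) = \sum_(1 <= p < X.+1 | prime p) ln p%:R * (logn p n)%:R.
Proof.
case/andP=> n0 nX; rewrite -{1}(partnT n0) (widen_partn _ nX).
rewrite big_mkcond big_ltn //= mul1n.
rewrite (bigID prime) /= [X in (_ * X)%N]big1 => [|p /negbTE np]; last first.
  by rewrite lognE np.
rewrite muln1 ln_prod_nat => [|p /= prp]; last by rewrite expn_gt0 prime_gt0.
apply: eq_bigr => p /= prp.
by rewrite natrX lnXn ?ltr0n ?prime_gt0 // mulr_natr.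
Qed.

(** A prime p contributes ln p once for each i >= 1 with p^i dividing n; the cut-off i <= X loses
    nothing because [logn p n] is below n. *)
Lemma ln_mangoldt_sum (R : realType) (X n : nat) : (0 < n <= X)%N ->
  ln (n%:R : R) = mangoldt_sum X (fun d => (d %| n)%:R).
Proof.
move=> nX; rewrite (ln_sum_logn R nX); apply: eq_bigr => p prp.
rewrite -mulr_sumr -natr_sum; congr (_ * _%:R).
rewrite -[LHS](@sum_nat_leq X); last first.
  by case/andP: nX => n0 nX; have := ltn_logl p n0; lia.
by apply: eq_bigr => i _; rewrite pfactor_dvdn //; case/andP: nX.
Qed.

(** Legendre's formula: passing from m to m + 1 raises the quotient by d exactly when d divides m +
    1. *)
Lemma ln_fact_mangoldt_sum (R : realType) (X m : nat) : (m <= X)%N ->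
  ln (m`!%:R : R) = mangoldt_sum X (fun d => (m %/ d)%:R).
Proof.
elim: m => [|m IHm] mX.
  rewrite fact0 ln1 -(mangoldt_sum0 R X).
  by apply: eq_bigr => p _; apply: eq_bigr => i _; rewrite div0n.
rewrite factS natrM lnM ?posrE ?ltr0n ?fact_gt0 // IHm ?(ltnW mX) //.
rewrite (@ln_mangoldt_sum R X m.+1) // -mangoldt_sumD.
apply: eq_bigr => p prp; apply: eq_bigr => i _.
by rewrite divnS ?expn_gt0 ?prime_gt0 // natrD.
Qed.

(** For odd m the two middle coefficients are equal, so each is at most half of 2^m. *)
Lemma bin_uphalf_le (m : nat) : ('C(m, uphalf m) <= 2 ^ (2 * m./2))%N.
Proof.
have le_sum k : (k <= m)%N -> ('C(m, k) <= \sum_(i < m.+1) 'C(m, i))%N.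
  by move=> km; rewrite (bigD1 (Ordinal (km : k < m.+1)%N)) //= leq_addr.
have sumE : (\sum_(i < m.+1) 'C(m, i) = 2 ^ m)%N.
  rewrite -[2%N]/(1 + 1)%N expnDn.
  by apply: eq_bigr => i _; rewrite !exp1n !muln1.
have [om|em] := boolP (odd m); last first.
  have -> : (2 * m./2 = m)%N by lia.
  by rewrite -sumE; apply: le_sum; lia.
have hm : (uphalf m < m.+1)%N by lia.
have hm' : (m./2 < m.+1)%N by lia.
have mE : m = (2 * m./2).+1 by lia.
have := sumE; rewrite (bigD1 (Ordinal hm)) //= (bigD1 (Ordinal hm')) /=; last first.
  by rewrite -val_eqE /=; lia.
have -> : ('C(m, m./2) = 'C(m, uphalf m))%N.
  by rewrite -bin_sub; [congr ('C(_, _)); lia | lia].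
by rewrite [in (2 ^ m)%N]mE expnS; lia.
Qed.

(** Chebyshev's bound on psi. With h = [uphalf m], psi(m) - psi(h) <= ln C(m, h) <= 2(m - h) ln 2,
    and induction bounds psi(h). Rounding h up makes m - h <= h, so for d > h both h and m - h have
    quotient 0 by d. *)
Lemma psi_le (R : realType) (X m : nat) : (m <= X)%N ->
  mangoldt_sum X (fun d => (d <= m)%N%:R) <= 2 * m%:R * ln 2 :> R.
Proof.
have ln2 : 0 < ln (2 : R) by rewrite ln_gt0 // ltr1n.
elim/ltn_ind: m => m IHm mX.
have [m1|m2] := leqP m 1.
  apply: (@le_trans _ _ 0); last by rewrite !mulr_ge0 // ltW.
  rewrite -(mangoldt_sum0 R X); apply: mangoldt_sum_le => d d1.
  by rewrite leqNgt (leq_ltn_trans m1 d1).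
pose h := uphalf m.
have hm : (h < m)%N by rewrite /h; lia.
have IH := IHm h hm (ltnW (leq_trans hm mX)).
have lnC : ln ('C(m, h)%:R : R) <= (2 * (m - h)%N%:R) * ln 2.
  rewrite -natrM mulr_natl -lnXn // -natrX ler_ln ?posrE ?ltr0n ?bin_gt0 //.
  - have -> : (m - h = m./2)%N by rewrite /h; lia.
    by rewrite ler_nat bin_uphalf_le.
  - exact: ltnW.
  - by rewrite expn_gt0.
have fE : ln (m`!%:R : R) = ln ('C(m, h)%:R) + ln h`!%:R + ln (m - h)`!%:R.
  rewrite -(bin_fact (ltnW hm)) mulnA !natrM.
  by rewrite !lnM ?posrE ?mulr_gt0 ?ltr0n ?fact_gt0 ?bin_gt0 // ltnW.
have leL : mangoldt_sum X (fun d => (d <= m)%N%:R) + ln h`!%:R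
    + ln (m - h)`!%:R <=
    mangoldt_sum X (fun d => (d <= h)%N%:R) + ln m`!%:R :> R.
  rewrite !(@ln_fact_mangoldt_sum R X); [|lia..].
  rewrite -!mangoldt_sumD; apply: mangoldt_sum_le => d d1.
  rewrite -!natrD ler_nat.
  have [dh|hd] := leqP d h.
    have -> : (d <= m)%N by lia.
    by rewrite -addnA leq_add2l -{2}(subnKC (ltnW hm)) divnD ?leq_addr //; lia.
  have mh : (m - h <= h)%N by rewrite /h; lia.
  rewrite (divn_small hd) (divn_small (leq_ltn_trans mh hd)) !addn0 add0n.
  by case: (leqP d m) => // dm; rewrite divn_gt0; lia.
move: leL; rewrite fE; have -> : m%:R = h%:R + (m - h)%N%:R :> R.
  by rewrite -natrD subnKC // ltnW.
by lra.
Qed.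

(** * Logarithms of the integers in a class modulo 12 *)

Definition log_sum (R : realType) (a y : nat) : R :=
  \sum_(1 <= n < y.+1 | (n %% 12 == a)%N) ln n%:R.

(** Closed form, for a unit a modulo 12, of the number of j in 1..u with jb = a modulo 12. Every
    unit b modulo 12 is its own inverse, so the condition reads j = ab; a non-unit b admits no j. *)
Definition class_count (a b u : nat) : nat :=
  (if coprime 12 b then (u + 12 - (a * b) %% 12) %/ 12 else 0)%N.

Lemma sum_dvd_class (a d y : nat) : (0 < d)%N ->
  (\sum_(1 <= n < y.+1 | (n %% 12 == a)%N) (d %| n) =
   \sum_(1 <= j < (y %/ d).+1) ((j * d) %% 12 == a))%N.
Proof.
move=> d0; elim: y => [|y IHy]; first by rewrite div0n !big_geq.
rewrite big_mkcond big_nat_recr //= -big_mkcond /= IHy divnS //.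
case: (boolP (d %| y.+1)%N) => [dy|_]; last by rewrite add0n if_same addn0.
rewrite add1n [RHS]big_nat_recr //=; congr (_ + _)%N.
have -> : ((y %/ d).+1 * d = y.+1)%N.
  by rewrite -(divnK dy) divnS // dy.
by case: eqP.
Qed.

Lemma class_countE (a d u : nat) : a \in [:: 1; 5; 7; 11]%N ->
  (\sum_(1 <= j < u.+1) ((j * d) %% 12 == a) = class_count a (d %% 12)%N u)%N.
Proof.
move=> ha; under eq_bigr => j _ do rewrite -modnMmr.
have : (d %% 12 < 12)%N by rewrite ltn_mod.
move: (d %% 12)%N => b b12.
elim: u => [|u IHu].
  rewrite big_geq //; move: ha b b12; rewrite !inE.
  by case/or4P=> /eqP ->; do 12?[case=> //].
rewrite big_nat_recr //= IHu /class_count; move: ha b b12 {IHu}; rewrite !inE.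
by case/or4P=> /eqP ->; do 12?[case=> [_ /=|//]] => //=; lia.
Qed.

(** Expand each ln n over the divisors d of n and exchange the sums: the multiples n = jd in the
    class are counted by j. *)
Lemma log_sum_mangoldt_sum (R : realType) (X a y : nat) :
  a \in [:: 1; 5; 7; 11]%N -> (y <= X)%N ->
  log_sum R a y = mangoldt_sum X (fun d => (class_count a (d %% 12)%N (y %/ d)%N)%:R).
Proof.
move=> ha yX.
transitivity (\sum_(1 <= n < y.+1 | (n %% 12 == a)%N)
    mangoldt_sum X (fun d => (d %| n)%:R : R)).
  rewrite /log_sum big_nat_cond [RHS]big_nat_cond.
  by apply: eq_bigr => n ny; rewrite (@ln_mangoldt_sum R X) //; lia.
rewrite /mangoldt_sum exchange_big; apply: eq_bigr => p prp.
rewrite exchange_big; apply: eq_bigr => i _; rewrite -mulr_sumr -natr_sum.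
by rewrite sum_dvd_class ?class_countE // expn_gt0 prime_gt0.
Qed.

(** The weight W(d) is [weight_pos] minus [weight_neg] at b = d mod 12, t = [x %/ d]; two separate
    sums avoid truncated subtraction. *)
Definition weight_pos (b t : nat) : nat :=
  (class_count 11 b t + class_count 7 b (t %/ 10) + class_count 1 b (t %/ 35))%N.

Definition weight_neg (b t : nat) : nat :=
  (class_count 11 b (t %/ 2) + class_count 7 b (t %/ 5)
   + class_count 5 b (t %/ 7) + class_count 1 b (t %/ 10)
   + class_count 11 b (t %/ 10) + class_count 7 b (t %/ 14)
   + class_count 1 b (t %/ 70))%N.

Lemma class_count_period (a b u v : nat) :
  class_count a b (v * 12 + u)%N = (coprime 12 b * v + class_count a b u)%N.
Proof.
rewrite /class_count; case: coprime => //.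
have : ((a * b) %% 12 < 12)%N by rewrite ltn_mod.
by move: ((a * b) %% 12)%N => c c12; lia.
Qed.

(* The coefficients c of the terms c A_a(x/k) satisfy sum c/k = 0, so the weight
   of d depends only on d modulo 12 and on t = x %/ d modulo 840 = 12 * 70. *)
Lemma weight_le (b t : nat) : (b < 12)%N ->
  (weight_pos b t <= weight_neg b t + ((b == 11) && (t == 1)) + (29 <= t) + (72 <= t))%N.
Proof.
move=> b12; have bi : b \in iota 0 12 by rewrite mem_iota.
(* The bound with [+ 2] over a full period serves t >= 840, where the indicators of 29 <= t and 72
   <= t are both 1. *)
have chk : all (fun b => all (fun t => ((weight_pos b t <= weight_neg b t + 2) &&
    (weight_pos b t <= weight_neg b t + ((b == 11) && (t == 1)) + (29 <= t) + (72 <= t)))%N)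
    (iota 0 840)) (iota 0 12).
  by vm_compute.
move/allP: chk => /(_ _ bi)/allP chk.
have [t840|t840] := ltnP t 840.
  by have /andP[] : _ := chk t ltac:(rewrite mem_iota; lia).
pose q := (t %/ 840)%N; pose r := (t %% 840)%N.
have tE : t = (q * 840 + r)%N by rewrite /q /r -divn_eq.
have r840 : (r < 840)%N by rewrite ltn_mod.
have /andP[chk2 _] := chk r ltac:(rewrite mem_iota; lia).
have [-> ->] : (29 <= t /\ 72 <= t)%N by lia.
have cE a k l : (k * l = 70)%N ->
    class_count a b (t %/ k)%N = (coprime 12 b * (q * l) + class_count a b (r %/ k)%N)%N.
  move=> kl; rewrite -class_count_period; congr class_count.
  have k0 : (0 < k)%N by case: k kl.
  by rewrite tE -divnMDl //; congr (_ %/ _)%N; nia.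
(* For b coprime to 12 the shift by 840q adds 70 + 7 + 2 = 79 times q on the left and 35 + 14 + 10 +
   7 + 7 + 5 + 1 = 79 times q on the right; otherwise it adds 0. *)
have := chk2; rewrite /weight_pos /weight_neg -{1}(divn1 t) -{1}(divn1 r).
rewrite (@cE 11 1 70)%N // (@cE 7 10 7)%N // (@cE 1 35 2)%N // (@cE 11 2 35)%N //.
rewrite (@cE 7 5 14)%N // (@cE 5 7 10)%N // (@cE 1 10 7)%N // (@cE 11 10 7)%N //.
rewrite (@cE 7 14 5)%N // (@cE 1 70 1)%N //.
by case: coprime; lia.
Qed.

(** * Comparison with y ln y - y, an antiderivative of ln *)

Definition xlnx (R : realType) (y : R) : R := y * ln y - y.

Lemma xlnx_step_le (R : realType) (y h : R) : 0 < y -> 0 <= h ->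
  xlnx (y + h) - xlnx y <= h * ln (y + h).
Proof.
move=> y0 h0; have yh0 : 0 < y + h by lra.
have : ln (1 + h / y) <= h / y by apply: le_ln1Dx; have := divr_ge0 h0 (ltW y0); lra.
have -> : 1 + h / y = (y + h) / y by field; rewrite gt_eqF.
rewrite ln_div ?posrE // ler_pdivlMr // /xlnx => le.
by nra.
Qed.

Lemma xlnx_step_ge (R : realType) (y h : R) : 0 < y -> 0 <= h ->
  h * ln y <= xlnx (y + h) - xlnx y.
Proof.
move=> y0 h0; have yh0 : 0 < y + h by lra.
have : ln (1 + (- h / (y + h))) <= - h / (y + h).
  by apply: le_ln1Dx; rewrite ltr_pdivlMr //; lra.
have -> : 1 + (- h / (y + h)) = y / (y + h) by field; rewrite gt_eqF.
rewrite ln_div ?posrE // ler_pdivlMr // /xlnx => le.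
by nra.
Qed.

Lemma xlnx_le (R : realType) (y z : R) : 1 <= y -> y <= z -> xlnx y <= xlnx z.
Proof.
move=> y1 yz; have := @xlnx_step_ge R y (z - y).
rewrite (_ : y + (z - y) = z); last by lra.
by have := ln_ge0 y1; nra.
Qed.

(* The least integer n > y with n = a modulo 12, for 0 < a < 12. *)
Definition next_in_class (a y : nat) : nat := (a + 12 * ((y + 12 - a) %/ 12))%N.

(** Each new term ln n moves z from n to n + 12, and the increment of [xlnx] lies between 12 ln n
    and 12 ln (n + 12). The lower bounds telescope with loss 12 ln z. *)
Lemma log_sum_bounds (R : realType) (a y : nat) : (0 < a < 12)%N ->
  let z : R := (next_in_class a y)%:R in
  xlnx z - xlnx a%:R - 12 * ln z <= 12 * log_sum R a y <= xlnx z - xlnx a%:R.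
Proof.
move=> /andP[a0 a12]; elim: y => [|y IHy] /=.
  rewrite /log_sum big_geq // /next_in_class divn_small; last by lia.
  by rewrite muln0 addn0 mulr0; have := ln_nat_ge0 R a; lra.
rewrite /log_sum big_mkcond big_nat_recr //= -big_mkcond /= -/(log_sum R a y).
have [ya|ya] := eqVneq (y.+1 %% 12)%N a; last first.
  rewrite addr0; suff -> : next_in_class a y.+1 = next_in_class a y by [].
  by rewrite /next_in_class; lia.
have n1 : next_in_class a y = y.+1 by rewrite /next_in_class; lia.
have n2 : next_in_class a y.+1 = (y.+1 + 12)%N by rewrite /next_in_class; lia.
rewrite n1 in IHy; rewrite n2 natrD.
have y0 : 0 < y.+1%:R :> R by rewrite ltr0n.
have := xlnx_step_le y0 (ler0n R 12); have := xlnx_step_ge y0 (ler0n R 12).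
case/andP: IHy; move: (xlnx _) (xlnx _) (xlnx _) => u v w; lra.
Qed.

Lemma ln2_ge_half (R : realType) : 2^-1 <= ln (2 : R).
Proof.
have := @le_ln1Dx R (2^-1 - 1); rewrite (_ : 1 + (2^-1 - 1) = 2^-1); last by lra.
by rewrite lnV ?posrE //; lra.
Qed.

(** The next class member lies in [z, z + 12], so replacing it by z costs at most 12 ln (x + 12);
    the remaining errors of [log_sum_bounds] cost at most as much again. *)
Lemma log_sum_div_bounds (R : realType) (a k x : nat) :
  (0 < a < 12)%N -> (0 < k)%N -> (k <= x)%N ->
  let z : R := x%:R / k%:R in
  xlnx z - 24 * ln (x + 12)%:R <= 12 * log_sum R a (x %/ k)
    <= xlnx z + 24 * ln (x + 12)%:R.
Proof.
move=> a12 k0 kx /=; set z := x%:R / k%:R.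
have kR : 0 < k%:R :> R by rewrite ltr0n.
have z1 : 1 <= z by rewrite /z ler_pdivlMr // mul1r ler_nat.
have zx : z <= x%:R by rewrite ler_pdivrMr // ler_peMr // ler1n.
pose n := next_in_class a (x %/ k).
have /andP[nlo nhi] : (x %/ k < n <= x %/ k + 12)%N.
  by rewrite /n /next_in_class; move: (x %/ k)%N => y; lia.
have zn : z <= n%:R.
  rewrite /z ler_pdivrMr // -natrM ler_nat ltnW // -ltn_divLR //.
have nz : n%:R <= z + 12.
  apply: (@le_trans _ _ ((x %/ k)%:R + 12)); first by rewrite -natrD ler_nat.
  by rewrite lerD2r /z ler_pdivlMr // -natrM ler_nat leq_divM.
have x12 : z + 12 <= (x + 12)%:R by rewrite natrD lerD2r.
have L0 : ln (n%:R : R) <= ln (x + 12)%:R by rewrite ler_ln ?posrE; lra.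
have L1 : ln (z + 12) <= ln (x + 12)%:R by rewrite ler_ln ?posrE; lra.
have /andP[a0 alt12] := a12.
have L2 : ln (a%:R : R) <= ln (x + 12)%:R.
  rewrite ler_ln ?posrE ?ltr0n ?addn_gt0 ?orbT // ler_nat.
  by apply: leq_trans (leq_addl x 12); exact: ltnW.
have L3 : 1 <= 12 * ln (x + 12)%:R :> R.
  have : ln (2 : R) <= ln (x + 12)%:R.
    by rewrite ler_ln ?posrE ?ltr0n ?addn_gt0 ?orbT // ler_nat ltn_addl.
  by have := ln2_ge_half R; lra.
have g1 := xlnx_le z1 zn.
have g2 : xlnx n%:R <= xlnx (z + 12) by apply: xlnx_le => //; lra.
have g3 : xlnx (z + 12) - xlnx z <= 12 * ln (z + 12) by apply: xlnx_step_le; lra.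
have a1 : 1 <= a%:R :> R by rewrite ler1n.
have a12R : a%:R <= 12 :> R by rewrite ler_nat ltnW.
have g4 : -1 <= xlnx (a%:R : R).
  by have := @xlnx_le R 1 a%:R; rewrite {1}/xlnx ln1; lra.
have g5 : xlnx (a%:R : R) <= 12 * ln (x + 12)%:R.
  by rewrite /xlnx; have := ln_nat_ge0 R a; nra.
have /= := log_sum_bounds R (x %/ k) a12; rewrite -/n.
by move=> /andP[lo hi]; apply/andP; split; lra.
Qed.

(** * Primes congruent to 11 modulo 12 in (x/2, x] *)

Lemma log_sum_weight_le (R : realType) (x : nat) :
  log_sum R 11 x + log_sum R 7 (x %/ 10) + log_sum R 1 (x %/ 35) <=
  log_sum R 11 (x %/ 2) + log_sum R 7 (x %/ 5) + log_sum R 5 (x %/ 7)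
  + log_sum R 1 (x %/ 10) + log_sum R 11 (x %/ 10) + log_sum R 7 (x %/ 14)
  + log_sum R 1 (x %/ 70)
  + mangoldt_sum x (fun d => ((d %% 12 == 11) && (x %/ d == 1))%N%:R)
  + mangoldt_sum x (fun d => (d <= x %/ 29)%N%:R)
  + mangoldt_sum x (fun d => (d <= x %/ 72)%N%:R).
Proof.
rewrite !(@log_sum_mangoldt_sum R x) ?leq_div //.
rewrite -!mangoldt_sumD; apply: mangoldt_sum_le => d d1.
rewrite -!natrD ler_nat.
have := @weight_le (d %% 12) (x %/ d); rewrite /weight_pos /weight_neg ltn_mod => /(_ isT).
have lE k : (0 < k)%N -> (d <= x %/ k = (k <= x %/ d))%N.
  by move=> k0; rewrite !leq_divRL //; [rewrite mulnC | lia].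
by rewrite !lE // !(divnAC _ d).
Qed.

(** Here s is the integer square root of x. A prime p > s contributes nothing: i = 1 is ruled out by
    hypothesis and p^2 > x. A prime p <= s has at most log_p x powers up to x, contributing at most
    ln x. *)
Lemma prime_power_sum_le (R : realType) (x s : nat) :
  (s * s <= x < s.+1 * s.+1)%N ->
  (forall p, prime p -> (p %% 12 = 11)%N -> (x %/ p)%N != 1%N) ->
  mangoldt_sum x (fun d => ((d %% 12 == 11) && (x %/ d == 1))%N%:R)
    <= s%:R * ln x%:R :> R.
Proof.
move=> /andP[sx xs] nop.
have lnx := ln_nat_ge0 R x.
have inner p : prime p -> \sum_(1 <= i < x.+1)
    ln p%:R * ((p ^ i %% 12 == 11) && (x %/ p ^ i == 1))%N%:R
    <= (p <= s)%N%:R * ln x%:R :> R.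
  move=> prp; have p1 := prime_gt1 prp; have p0 := prime_gt0 prp.
  have [ps|sp] := leqP p s.
    have x0 : (0 < x)%N by nia.
    have /andP[lo hi] := trunc_log_bounds p1 x0.
    apply: (@le_trans _ _ (ln p%:R * (trunc_log p x)%:R)).
      rewrite -mulr_sumr ler_wpM2l ?ln_nat_ge0 // -natr_sum ler_nat.
      rewrite -[leqRHS](@sum_nat_leq x); last first.
        by apply: leq_trans lo; apply: ltnW; exact: ltn_expl.
      apply: leq_sum => i _; case: (leqP i) => [_|ki]; first exact: leq_b1.
      rewrite (_ : (x %/ p ^ i)%N = 0%N) ?andbF // divn_small //.
      by apply: leq_trans hi _; rewrite leq_exp2l.
    rewrite mulr_natr -lnXn ?ltr0n // -natrX mul1r.
    by rewrite ler_ln ?posrE ?ltr0n ?ler_nat ?expn_gt0 ?p0.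
  rewrite mul0r big_nat big1 // => i /andP[i0 _].
  have [i1|i2] : i = 1%N \/ (2 <= i)%N by lia.
    rewrite i1 expn1; case: eqP => [p11|_]; last by rewrite mulr0.
    by rewrite (negbTE (nop p prp p11)) mulr0.
  rewrite (_ : (x %/ p ^ i)%N = 0%N) ?andbF ?mulr0 // divn_small //.
  apply: leq_trans xs _; apply: (@leq_trans (p ^ 2)%N); last by rewrite leq_exp2l.
  by rewrite -mulnn leq_mul.
apply: (@le_trans _ _ (\sum_(1 <= p < x.+1 | prime p) (p <= s)%N%:R * ln x%:R)).
  by apply: ler_sum => p; exact: inner.
apply: (@le_trans _ _ (\sum_(1 <= p < x.+1) (p <= s)%N%:R * ln x%:R)).
  rewrite big_mkcond; apply: ler_sum => p _; case: ifP => // _.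
  by rewrite mulr_ge0.
by rewrite -mulr_suml -natr_sum sum_nat_leq //; nia.
Qed.

Lemma ln_pow_le (R : realType) (a b i j : nat) : (0 < a)%N -> (0 < b)%N ->
  (a ^ i <= b ^ j)%N -> i%:R * ln (a%:R : R) <= j%:R * ln b%:R.
Proof.
move=> a0 b0 ab; rewrite !mulr_natl -!lnXn ?ltr0n // -!natrX.
by rewrite ler_ln ?posrE ?ltr0n ?expn_gt0 ?a0 ?b0 // ler_nat.
Qed.

Lemma sqrt_nat_ex (x : nat) : exists s, (s * s <= x < s.+1 * s.+1)%N.
Proof.
elim: x => [|x [s /andP[sx xs]]]; first by exists 0%N.
have [xs1|xs1] := leqP (s.+1 * s.+1) x.+1; last by exists s; lia.
by exists s.+1; rewrite xs1 /=; nia.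
Qed.

(* 24 ln 2 + 10 ln 5 + 7 ln 7 >= (263 / 4) ln 2 since 5^4 > 2^9, 7^4 > 2^11. *)
Lemma log_sum_main_term (R : realType) (x : nat) : (70 <= x)%N ->
  263 / 1680 * ln 2 * x%:R - 20 * ln (x + 12)%:R <=
  log_sum R 11 x + log_sum R 7 (x %/ 10) + log_sum R 1 (x %/ 35)
  - (log_sum R 11 (x %/ 2) + log_sum R 7 (x %/ 5) + log_sum R 5 (x %/ 7)
  + log_sum R 1 (x %/ 10) + log_sum R 11 (x %/ 10) + log_sum R 7 (x %/ 14)
  + log_sum R 1 (x %/ 70)).
Proof.
move=> x70; have x0 : 0 < x%:R :> R by rewrite ltr0n; lia.
have gE k : (0 < k)%N ->
    xlnx (x%:R / k%:R : R) = x%:R / k%:R * (ln x%:R - ln k%:R) - x%:R / k%:R.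
  by move=> k0; rewrite /xlnx ln_div ?posrE ?x0 ?ltr0n.
have l5 : 9 * ln 2 <= 4 * ln 5 :> R by exact: (@ln_pow_le R 2 5 9 4).
have l7 : 11 * ln 2 <= 4 * ln 7 :> R by exact: (@ln_pow_le R 2 7 11 4).
have lM a b : (0 < a)%N -> (0 < b)%N -> ln ((a * b)%:R : R) = ln a%:R + ln b%:R.
  by move=> a0 b0; rewrite natrM lnM ?posrE ?ltr0n.
have l10 : ln 10 = ln 2 + ln 5 :> R := lM 2 5 isT isT.
have l14 : ln 14 = ln 2 + ln 7 :> R := lM 2 7 isT isT.
have l35 : ln 35 = ln 5 + ln 7 :> R := lM 5 7 isT isT.
have l70 : ln 70 = ln 10 + ln 7 :> R := lM 10 7 isT isT.
have B a k (ha : (0 < a < 12)%N) (hk : (0 < k)%N) (h70 : (k <= 70)%N) :=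
  andP (@log_sum_div_bounds R a k x ha hk (leq_trans h70 x70)).
have [b1 _] := B 11 1 isT isT isT; have [b2 _] := B 7 10 isT isT isT.
have [b3 _] := B 1 35 isT isT isT; have [_ b4] := B 11 2 isT isT isT.
have [_ b5] := B 7 5 isT isT isT; have [_ b6] := B 5 7 isT isT isT.
have [_ b7] := B 1 10 isT isT isT; have [_ b8] := B 11 10 isT isT isT.
have [_ b9] := B 7 14 isT isT isT; have [_ b10] := B 1 70 isT isT isT.
rewrite gE //= ?ln1 ?divn1 in b1; rewrite gE //= l10 in b2.
rewrite gE //= l35 in b3; rewrite gE //= in b4; rewrite gE //= in b5.
rewrite gE //= in b6; rewrite gE //= l10 in b7; rewrite gE //= l10 in b8.
rewrite gE //= l14 in b9; rewrite gE //= l70 l10 in b10.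
(* The terms in x ln x and x cancel, leaving (24 ln 2 + 10 ln 5 + 7 ln 7) x / 420; the ten errors of
   2 ln (x + 12) make 20. *)
have m5 := ler_wpM2r (ltW x0) l5; have m7 := ler_wpM2r (ltW x0) l7.
by lra.
Qed.

(** The tangent of ln at 512 = 2^9, with slope enlarged by 1 <= 2 ln 2 so that ln 2 factors out. *)
Lemma ln_le_affine (R : realType) (n : nat) : (512 <= n)%N ->
  ln (n%:R : R) <= ln 2 * (7 + n%:R / 256).
Proof.
move=> n512; have v1 : 1 <= n%:R / 512 :> R by rewrite ler_pdivlMr // mul1r ler_nat.
have v0 := lt_le_trans ltr01 v1.
have -> : ln (n%:R : R) = 9 * ln 2 + ln (n%:R / 512).
  by rewrite mulr_natl -lnXn // -lnM ?posrE ?exprn_gt0 //; congr ln; lra.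
have /(@le_ln1Dx R) : -1 < n%:R / 512 - 1 :> R by lra.
rewrite (_ : 1 + (n%:R / 512 - 1) = n%:R / 512); last by lra.
have l2 : 0 <= 2 * ln 2 - 1 :> R by have := ln2_ge_half R; lra.
have v2 : 0 <= n%:R / 512 - 1 :> R by lra.
by have := mulr_ge0 l2 v2; lra.
Qed.

(** Used with l = ln 2, X = x, u the integer square root of x and y = ln (x + 12). Dividing by l
    leaves a quadratic inequality in u that fails from 512 on. *)
Lemma square_beats_log (R : realType) (l u X y : R) : 0 < l -> 512 <= u ->
  u * u <= X -> y <= 2 * (l * (7 + (u + 2) / 256)) ->
  (263 / 1680 - 2 / 29 - 2 / 72) * l * X <= (u + 20) * y -> False.
Proof.
move=> l0 u512 uX yle le.
have u20 : 0 <= u + 20 by lra.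
have h1 := ler_wpM2l u20 yle.
have h2 := ler_wpM2l (ltW l0) uX.
have : l * ((263 / 1680 - 2 / 29 - 2 / 72) * (u * u)
            - (u + 20) * (14 + (u + 2) / 128)) <= 0 by lra.
by rewrite pmulr_rle0 //; nra.
Qed.

Lemma prime_11_mod_12_gap_false (R : realType) (x : nat) : (512 * 512 <= x)%N ->
  ~ (forall p, prime p -> (p %% 12 = 11)%N -> (x %/ p)%N != 1%N).
Proof.
move=> x18 nop; have [s sx] := sqrt_nat_ex x.
have s512 : (512 <= s)%N by rewrite leqNgt; apply/negP => s512; nia.
have x70 : (70 <= x)%N by apply: leq_trans x18.
have x0 : (0 < x)%N by exact: leq_trans x70.
have xs12 : ((x + 12) ^ 1 <= (s + 2) ^ 2)%N.
  by rewrite -mulnn; case/andP: sx; nia.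
have uX : s%:R * s%:R <= x%:R :> R by rewrite -natrM ler_nat; case/andP: sx.
have ppl := prime_power_sum_le R sx nop.
have lnx : ln (x%:R : R) <= ln (x + 12)%:R.
  by rewrite ler_ln ?posrE ?ltr0n ?addn_gt0 ?x0 // ler_nat leq_addr.
have y2 : ln ((x + 12)%:R : R) <= 2 * ln (s + 2)%:R.
  rewrite -[leLHS]mul1r; apply: (@ln_pow_le R (x + 12) (s + 2) 1 2) => //.
    by rewrite addn_gt0 x0.
  by rewrite addn_gt0 orbT.
have l0 : 0 < ln 2 :> R by have := ln2_ge_half R; lra.
have floor k : (0 < k)%N -> (x %/ k)%:R * ln 2 <= x%:R / k%:R * ln 2 :> R.
  move=> k0; rewrite ler_wpM2r ?(ltW l0) //.
  by rewrite ler_pdivlMr ?ltr0n // -natrM ler_nat leq_divM.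
have f29 := floor 29 isT; have f72 := floor 72 isT.
have psi29 := psi_le R (leq_div x 29); have psi72 := psi_le R (leq_div x 72).
apply: (@square_beats_log R (ln 2) s%:R x%:R (ln (x + 12)%:R)) => //.
- by rewrite ler_nat.
- apply: (le_trans y2); rewrite ler_wpM2l //.
  by have := @ln_le_affine R (s + 2); rewrite natrD; apply; exact: leq_trans (leq_addr _ _).
have ppl' := le_trans ppl (ler_wpM2l (ler0n R s) lnx).
have := log_sum_main_term R x70; have := log_sum_weight_le R x.
by lra.
Qed.

(** The intervals [q, 2q) of a chain that at most doubles at each step leave no gaps. *)
Lemma doubling_chain (x p : nat) (c : seq nat) :
  path (fun p q => q <= 2 * p)%N p c -> (p <= x < 2 * last p c)%N ->
  exists2 q, q \in p :: c & (q <= x < 2 * q)%N.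
Proof.
elim: c p => [|q c IHc] p /=; first by exists p; rewrite ?inE.
case/andP=> qp pc /andP[px xc]; have [qx|xq] := leqP q x.
  have [|r rqc rx] := IHc q pc; first by rewrite qx.
  by exists r; rewrite // inE rqc orbT.
by exists p; rewrite ?mem_head // px (leq_trans xq).
Qed.

Lemma divn_eq1 (x p : nat) : (0 < p)%N -> (x %/ p == 1)%N = (p <= x < 2 * p)%N.
Proof. by move=> p0; rewrite eqn_leq -ltnS ltn_divLR // leq_divRL // mul1n andbC. Qed.

Lemma prime_11_mod_12_bertrand (x : nat) : (47 <= x)%N ->
  exists p, [/\ prime p, (p %% 12 = 11)%N & (p <= x < 2 * p)%N].
Proof.
move=> x47; pose P p := [&& prime p, p %% 12 == 11 & x %/ p == 1]%N.
have [/hasP[p _ /and3P[prp /eqP p11]]|/hasPn noP] := boolP (has P (iota 0 x.+1)).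
  by rewrite divn_eq1 ?prime_gt0 // => px; exists p.
have [x18|x18] := leqP (512 * 512) x.
  case: (@prime_11_mod_12_gap_false Rdefinitions.R x x18) => p prp p11.
  have [px|xp] := leqP p x; last by rewrite divn_small.
  have := noP p; rewrite mem_iota /P prp p11 eqxx /=; apply.
  by rewrite ltnS.
(* Primes 11 modulo 12, each at most twice the one before; twice the last exceeds 512^2. *)
pose c := [:: 83; 131; 251; 491; 971; 1931; 3851; 7691; 15359; 30707;
              61403; 122663; 245291]%N.
have [||q qc xq] := @doubling_chain x 47 c; first by vm_compute.
  rewrite x47 /=; apply: leq_trans x18 _; by vm_compute.
have : all (fun q => prime q && (q %% 12 == 11))%N (47 :: c)%N by vm_compute.
by move=> /allP/(_ _ qc)/andP[prq /eqP q11]; exists q.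
Qed.

Local Close Scope ring_scope.

(** * The least modulus as a least prime *)

Theorem theorem1p3 (d n : nat) (hd : d \in [:: 4; 6; 12]) (hn : 2 < n) :
  is_least
    [pred p : nat | [&& prime p, 2 * n - 1 <= p & (p == -1 %[mod d])%Z]]
    (lambda d n).
Proof.
have d0 : 0 < d by move: hd; rewrite !inE => /or3P[] /eqP ->.
have d12 : d %| 12 by move: hd; rewrite !inE => /or3P[] /eqP ->.
have [/andP[m1 dist] min] := lambdaP n d0.
(* Hence the least modulus is at most every candidate prime; it remains to see that it is itself a
   candidate. *)
have works q : prime q -> 2 * n - 1 <= q -> d %| q.+1 -> lambda d n <= q.
  move=> prq nq dq; apply: min; apply/andP; split; first exact: prime_gt1.
  apply: odd_powers_distinct_prime => //.
  by case: (even_prime prq) => // q2; lia.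
split => [|q /= /and3P[prq nq]]; last by rewrite eq_opp1_modz; exact: works.
rewrite /= eq_opp1_modz.
have [n14|n14] := ltnP 14 n.
  (* From q <= 4n - 4 < 2q follows q >= 2n - 1, so q is a candidate and bounds the least modulus by
     4n - 4. *)
  have [|q [prq q11 qn]] := @prime_11_mod_12_bertrand (4 * n - 4); first by lia.
  apply: (@odd_powers_distinct_minimal d n _ q) => //; last by lia.
  by apply: works => //; [lia | apply: dvdn_trans d12 _; lia].
have n3_14 : n \in iota 3 12 by rewrite mem_iota; lia.
have [q /and3P[prq nq dq]] := small_cases hd n3_14.
by apply=> //; apply: works.
Qed.
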